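(* Let $G$ be a countable group, let $A$ be a finite set, let $X \subset A^G$ be a subshift, and let $f : X \to X$ be a cellular automaton. Then $f$ is weakly preperiodic if and only if $f$ is preperiodic.
   Context: $A^G$ carries the product topology ($A$ discrete), and $G$ acts on it by the shift $\sigma^g(x)_h = x_{g^{-1}h}$. A subshift is a closed shift-invariant subset $X \subset A^G$. A cellular automaton on $X$ is a continuous map $f : X \to X$ commuting with $\sigma^g$ for all $g\in G$. $f$ is weakly preperiodic if for every $x \in X$ there exist integers $n \geq 0$, $p>0$ (depending on $x$) with $f^n(x) = f^{n+p}(x)$. $f$ is preperiodic if there exist integers $n \ge 0$, $p>0$ with $f^n = f^{n+p}$. *)

(* Defs.v *)
From mathcomp Require Import all_boot all_classical topology.

Set Implicit Arguments.
Unset Strict Implicit.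
Unset Printing Implicit Defensive.

Local Open Scope classical_set_scope.

Definition config (G : groupType) (A : finType) : topologicalType :=
  {ptws G -> discrete_topology A}.

Definition shift (G : groupType) (A : finType) (g : G) (x : config G A) :
  config G A := fun h => x (g^-1 * h)%g.

Definition shift_invariant (G : groupType) (A : finType)
  (X : set (config G A)) : Prop := forall g, shift g @` X `<=` X.

Definition subshift (G : groupType) (A : finType) (X : set (config G A)) :
  Prop := closed X /\ shift_invariant X.

Lemma shift_in (G : groupType) (A : finType) (X : set (config G A))
  (hX : subshift X) (g : G) (x : X) : shift g (set_val x) \in X.
Proof. by apply/mem_set/(proj2 hX g); exists (set_val x) => //; exact: set_valP. Qed.

Definition sub_shift (G : groupType) (A : finType) (X : set (config G A))
  (hX : subshift X) (g : G) (x : X) : X :=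
  exist _ (shift g (set_val x)) (shift_in hX g x).

(* The type X of points of the set X carries the topology induced by its
   inclusion into config G A. *)
Definition cellular_automaton (G : groupType) (A : finType)
  (X : set (config G A)) (hX : subshift X) (f : X -> X) : Prop :=
  continuous f /\ forall g x, f (sub_shift hX g x) = sub_shift hX g (f x).

Definition weakly_preperiodic (T : Type) (f : T -> T) : Prop :=
  forall x, exists n p : nat, 0 < p /\ iter n f x = iter (n + p) f x.

Definition preperiodic (T : Type) (f : T -> T) : Prop :=
  exists n p : nat, 0 < p /\ iter n f = iter (n + p) f.

(* Main.v *)
Require Import Defs.
From mathcomp Require Import all_boot all_classical topology.

Local Open Scope classical_set_scope.

(** Preperiodicity is uniform because equality of two iterates is a local
    condition.  Label a configuration by its symbol at the identity: labels of
    translates determine the configuration, so [f^n = f^(n+p)] holds on a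
    shift-invariant set as soon as the labels of [f^n x] and [f^(n+p) x] agree
    for every [x] in that set, and this agreement defines a clopen set.  The
    argument works for every compact space with such an expansive group action
    and a commuting continuous map ([expansive_preperiodic]).

    Suppose that [f] is weakly preperiodic but not preperiodic.

    - Minimality.  If [f] satisfies [f^n = f^(n+p)] on the intersection of a
      chain of closed subsystems, then the clopen agreement set contains that
      intersection, hence by compactness contains a member of the chain, and
      [f] is already preperiodic there.  Zorn's lemma thus gives a closed
      subsystem [Z] on which [f] is not preperiodic although it is preperiodic
      on every smaller closed subsystem ([maximal_obstruction], phrased with
      the open complement [U] of [Z]).

    - Category.  [Z] is covered by the closed sets of [x] with
      [f^k x = f^(k + k!) x].  By Baire ([baire_compact_clopen]) one of them
      contains a nonempty relatively clopen part [B] of [Z].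

    - Conclusion.  The points of [Z] no translate of whose forward orbit meets
      [B] form a smaller closed subsystem, on which [f^m = f^(m+q)] for some
      [m] and [q].  By compactness there is [N] such that every point of [Z]
      lies in the agreement set of [m] and [q] unless its orbit meets a
      translate of [B] at some time at most [N].  If this happens, [x] becomes
      periodic of period [k!] by time [N + k]; if it does not, all
      translates of [x] satisfy the agreement, and [f^m x = f^(m+q) x].
      Hence [f] is preperiodic on [Z], a contradiction. *)

(** * Compactness *)

Section Compactness.
Context {T : topologicalType} (cT : compact [set: T]).

(** Compactness in the form used below for increasing sequences and for chains:
    no finite subfamily has to be assembled. *)
Lemma directed_cover_compact (I : Type) (i0 : I) (O : I -> set T) :
  (forall i, open (O i)) ->
  (forall i j, exists k, O i `|` O j `<=` O k) ->
  (forall x, exists i, O i x) -> exists i, forall x, O i x.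
Proof.
move=> oO dO covO.
(* The filter of the cofinal sections of the directed index set. *)
pose F : set_system I := fun S => exists i, [set k | O i `<=` O k] `<=` S.
have filF : Filter F.
  split.
  - by exists i0.
  - move=> P Q [i iP] [j jQ]; have [k ijk] := dO i j.
    exists k => l kl; split.
      by apply: iP => x Ox; apply/kl/ijk; left.
    by apply: jQ => x Ox; apply/kl/ijk; right.
  - by move=> P Q PQ [i iP]; exists i => k /iP /PQ.
have /compact_near_coveringP/(_ I F (fun i x => O i x) filF) := cT.
case=> [x _|i /(_ i) Oi].
  have [i Oix] := covO x.
  exists (O i, [set k | O i `<=` O k]) => /=.
    by split; [exact: open_nbhs_nbhs | exists i].
  by move=> [y k] /= [Oiy]; exact.
by exists i => x; apply: Oi.
Qed.

(** A form of Baire's theorem in which the sets [E k] are closed because clopen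
    sets separate them from the points outside.  Otherwise, successive clopen
    refinements that avoid [E 0], [E 1], ... and meet [K] would decrease to a
    nonempty intersection in [K] covered by no [E k]. *)
Lemma baire_compact_clopen (K : set T) (E : nat -> set T) :
  closed K -> K !=set0 -> K `<=` \bigcup_k E k ->
  (forall k x, ~ E k x -> exists B, [/\ clopen B, B x & B `<=` ~` E k]) ->
  exists k B, [/\ clopen B, B `&` K !=set0 & B `&` K `<=` E k].
Proof.
move=> clK [x0 Kx0] KE sepE; apply: contrapT => noB.
pose good (B : set T) := clopen B /\ B `&` K !=set0.
have refine k (B : set T) : good B ->
    exists C : set T, [/\ good C, C `<=` B & C `<=` ~` E k].
  move=> [clB neB].
  have [x [Bx Kx nEx]] : exists x, [/\ B x, K x & ~ E k x].
    apply: contrapT => noX; apply: noB; exists k, B; split => // x [Bx Kx].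
    by apply: contrapT => nEx; apply: noX; exists x.
  have [C [clC Cx CE]] := sepE k x nEx.
  exists (B `&` C); split.
  - split; last by exists x.
    by split; [apply: openI; [exact: clB.1 | exact: clC.1]
              |apply: closedI; [exact: clB.2 | exact: clC.2]].
  - by move=> y [].
  - by move=> y [_ /CE].
(* The stage number is carried along, since the step depends on it. *)
pose R (p q : nat * {B | good B}) := q.1 = p.1.+1 /\
  (sval q.2 `<=` sval p.2 /\ sval q.2 `<=` ~` E p.1).
have goodT : good [set: T].
  by split; [split; [exact: openT | exact: closedT] | exists x0].
have [p|s [s0 sR]] := @dependent_choice _ R _ (0, exist _ _ goodT).
  apply: cid; case: p => k [B gB]; have [C [gC CB CE]] := refine k B gB.
  by exists (k.+1, exist _ C gC).
have sk k : (s k).1 = k.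
  by elim: k => [|k IH]; [rewrite s0 | rewrite (sR k).1 IH].
have s_mono i d : sval (s (d + i)%N).2 `<=` sval (s i).2.
  by elim: d => // d IH x; rewrite addSn => /(sR (d + i)%N).2.1 /IH.
have [||x|k] := @directed_cover_compact nat 0
    (fun k => ~` K `|` ~` sval (s k).2).
- move=> k; apply: openU; first exact: closed_openC.
  by apply: closed_openC; case: (svalP (s k).2) => -[].
- move=> i j; exists (i + j)%N => x [] [nK|nB]; try by left.
    by right => /= Bx; apply: nB; apply: (s_mono i j); rewrite addnC.
  by right => /= Bx; apply: nB; exact: s_mono Bx.
- have [Kx|nK] := pselect (K x); last by exists 0; left.
  have [k _ Ex] := KE x Kx; exists k.+1; right => /= Bx.
  by apply: (sR k).2.2 Bx _; rewrite sk.
case: (svalP (s k).2) => _ [x [Bx Kx]] /(_ x).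
by case; apply.
Qed.

End Compactness.

Lemma eventual_period_le (T : Type) (f : T -> T) n p m q x :
  n <= m -> p %| q -> iter n f x = iter (n + p) f x ->
  iter m f x = iter (m + q) f x.
Proof.
move=> nm /dvdnP[c ->] fx.
have nc : iter n f x = iter (n + c * p) f x.
  elim: c => [|c IH]; first by rewrite addn0.
  by rewrite mulSn addnA addnC iterD -fx -iterD addnC.
by rewrite -(subnK nm) -addnA !(iterD (m - n)) nc.
Qed.

(** * Expansive actions on compact spaces *)

Section ExpansiveAction.
Context {G : groupType} {T : topologicalType} {D : Type}.
Context (act : G -> T -> T) (e : T -> D) (f : T -> T).
Hypothesis cT : compact [set: T].
Hypothesis act1 : forall x, act 1%g x = x.
Hypothesis actM : forall g h x, act (g * h)%g x = act g (act h x).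
Hypothesis act_cont : forall g, continuous (act g).
Hypothesis e_open : forall a, open (e @^-1` [set a]).
Hypothesis e_sep : forall x y, (forall g, e (act g x) = e (act g y)) -> x = y.
Hypothesis f_cont : continuous f.
Hypothesis f_act : forall g x, f (act g x) = act g (f x).

Lemma iter_continuous n : continuous (iter n f).
Proof.
elim: n => [x|n IH x]; first exact: cvg_id.
by apply: continuous_comp; [exact: IH | exact: f_cont].
Qed.

Lemma iter_act n g x : iter n f (act g x) = act g (iter n f x).
Proof. by elim: n => //= n ->; rewrite f_act. Qed.

Lemma act_inj g : injective (act g).
Proof.
by move=> x y xy; rewrite -[x]act1 -[y]act1 -(mulVg g) !actM xy.
Qed.

(** The label is locally constant, so both agreement and disagreement are
    unions, over the possible labels, of open conditions. *)
Lemma clopen_label_agree (u v : T -> T) :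
  continuous u -> continuous v -> clopen [set x | e (u x) = e (v x)].
Proof.
move=> cu cv.
have opre w a : continuous w -> open [set x | e (w x) = a].
  by move=> cw; apply: (open_comp _ (e_open a)) => x _; exact: cw.
split.
  suff -> : [set x | e (u x) = e (v x)] =
      \bigcup_a ([set x | e (u x) = a] `&` [set x | e (v x) = a]).
    by apply: bigcup_open => a _; apply: openI; exact: opre.
  by apply/seteqP; split => [x /= uv|x [a _ [/= -> ->]]//]; exists (e (u x)).
rewrite -openC.
suff -> : ~` [set x | e (u x) = e (v x)] =
    \bigcup_(ab in [set ab | ab.1 <> ab.2])
       ([set x | e (u x) = ab.1] `&` [set x | e (v x) = ab.2]).
  by apply: bigcup_open => ab _; apply: openI; exact: opre.
apply/seteqP; split => [x /= uv|x [[a b] /= ab [/= -> ->]]//].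
by exists (e (u x), e (v x)).
Qed.

Definition periodic_pt n p := [set x | iter n f x = iter (n + p) f x].

Definition agree n p := [set x | e (iter n f x) = e (iter (n + p) f x)].

(** Expansiveness turns the infinitely many coordinates of [iter n f x] into the
    single clopen condition [agree n p], imposed on the orbit of [x]. *)
Lemma periodic_pt_agree n p x :
  (forall g, agree n p (act g x)) -> periodic_pt n p x.
Proof. by move=> ax; apply: e_sep => g; rewrite -!iter_act; exact: ax. Qed.

(** The complement of [U] is a subsystem; the open sets [U] are used in place of
    their closed complements because Zorn's lemma is applied to unions. *)
Definition coinvariant (U : set T) :=
  (forall g x, U (act g x) -> U x) /\ (forall x, U (f x) -> U x).

Definition preperiodic_off (U : set T) :=
  exists n p, 0 < p /\ ~` U `<=` periodic_pt n p.

(** Preperiodicity off the union of a chain passes to a member of the chain: off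
    the union the labels agree, so the open set [agree n p] and the chain cover
    the space, and by compactness [agree n p] and one member do. *)
Lemma maximal_obstruction : ~ preperiodic_off set0 ->
  exists U, [/\ open U, coinvariant U, ~ preperiodic_off U &
    forall V, open V -> coinvariant V -> U `<` V -> preperiodic_off V].
Proof.
move=> bad0.
pose P := [set U | [/\ open U, coinvariant U & ~ preperiodic_off U]].
have [F FP totF|U [[oU iU bU] maxU]] := @Zorn_bigcup T P.
  have oF : open (\bigcup_(X in F) X).
    by apply: bigcup_open => U /FP[].
  split => //.
    split=> [g x [U FU Ux]|x [U FU Ux]]; exists U => //;
      have [_ [ia ifx] _] := FP _ FU; [exact: ia Ux | exact: ifx].
  move=> [n [p [p0 UF]]].
  (* The empty set is adjoined so that the index set is inhabited even for
     an empty chain F. *)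
  pose good (U : set T) := F U \/ U = set0.
  pose O (U : {U | good U}) := agree n p `|` sval U.
  have g0 : good set0 by right.
  have [U|U V|x|[U gU] /= UT] := @directed_cover_compact T cT _ (exist _ _ g0) O.
  - apply: openU; first by case: (clopen_label_agree _ _ (iter_continuous n)
      (iter_continuous (n + p))).
    by case: U => U /= [/FP[]//|->]; exact: open0.
  - case: U V => [U gU] [V gV].
    have [UV|VU] : U `<=` V \/ V `<=` U.
      case: gU gV => [FU|->]; last by left.
      by case=> [FV|->]; [exact: totF | right].
    + by exists (exist _ V gV) => x [] [Cx|Ux]; by [left|right=>//; exact: UV].
    + by exists (exist _ U gU) => x [] [Cx|Ux]; by [left|right=>//; exact: VU].
  - have [[U FU Ux]|nFx] := pselect ((\bigcup_(X in F) X) x).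
      by exists (exist _ U (or_introl FU)); right.
    exists (exist _ _ g0); left; rewrite /agree /=.
    by rewrite (UF x nFx : iter n f x = _).
  have [_ [ia _] bU] : P U.
    case: (gU) => [/FP//|->]; split; [exact: open0 | by split | exact: bad0].
  apply: bU; exists n, p; split => // x nUx; apply: periodic_pt_agree => g.
  by case: (UT (act g x)) => // /ia.
exists U; split => // V oV iV UV; apply: contrapT => bV.
by apply: (maxU V UV).
Qed.

(** A chain or Baire argument alone gives no uniform bound: on a nonempty clopen
    part of the minimal subsystem the bound comes from [baire_compact_clopen],
    off the set of points that ever enter this part it comes from minimality,
    and compactness bounds the time of entry. *)
Theorem expansive_preperiodic :
  weakly_preperiodic f -> preperiodic f.
Proof.
move=> wf; apply: contrapT => bad.
have [|U [oU [iUa iUf] bU maxU]] := maximal_obstruction.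
  move=> [n [p [p0 np]]]; apply: bad; exists n, p; split => //.
  by apply: funext => x; exact: np.
have [|||k x nE|k [B [clB [x0 [Bx0 nUx0]] BE]]] := @baire_compact_clopen T cT (~` U)
    (* A sequence that exhausts all preperiods and, up to multiples, all periods. *)
    (fun k => periodic_pt k k`!).
- exact: open_closedC.
- apply: contrapT => noU; apply: bU; exists 0, 1; split => // x nUx.
  by case: noU; exists x.
- move=> x _; have [n [p [p0 fx]]] := wf x.
  exists (n + p) => //; apply: eventual_period_le fx; first exact: leq_addr.
  by rewrite dvdn_fact // p0 leq_addl.
- have [g ng] : exists g, ~ agree k k`! (act g x).
    apply: contrapT => noG; apply: nE; apply: periodic_pt_agree => g.
    by apply: contrapT => ng; apply: noG; exists g.
  pose u n y := iter n f (act g y).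
  have cu n : continuous (u n).
    move=> y; apply: (@continuous_comp _ _ _ (act g) (iter n f)).
      exact: act_cont.
    exact: iter_continuous.
  have [oA cA] := clopen_label_agree _ _ (cu k) (cu (k + k`!)%N).
  exists (~` [set y | e (u k y) = e (u (k + k`!)%N y)]); split => //.
    by split; [exact: closed_openC | exact: open_closedC].
  by move=> y nA Ey; apply: nA; rewrite /u /= !iter_act (Ey : _ = _).
(* The points some translate of which lies in B at time n. *)
pose W n := [set x | exists g, B (act g (iter n f x))].
have oW n : open (W n).
  rewrite (_ : W n = \bigcup_g [set x | B (act g (iter n f x))]).
    apply: bigcup_open => g _; apply: (open_comp _ clB.1) => x _.
    apply: (@continuous_comp _ _ _ (iter n f) (act g)); last exact: act_cont.
    exact: iter_continuous.
  by apply/seteqP; split=> [x [g Bx]|x [g _ Bx]]; exists g.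
have WE n x : ~ U x -> W n x -> periodic_pt (k + n) k`! x.
  move=> nUx [g Bx]; rewrite /periodic_pt /=.
  (* Injectivity of the translation carries periodicity from B back to x. *)
  rewrite addnAC (iterD k n) (iterD (k + _) n); apply: (@act_inj g).
  have nU : ~ U (act g (iter n f x)).
    move/iUa; elim: n {Bx} => //= n IH /iUf; exact: IH.
  by have := BE _ (conj Bx nU); rewrite /periodic_pt /= !iter_act.
pose V := U `|` \bigcup_n W n.
have oV : open V by apply: openU => //; apply: bigcup_open.
have iV : coinvariant V.
  split=> [g x [/iUa|[n _ [h Bx]]]|x [/iUf|[n _ [h Bx]]]]; try by left.
    by right; exists n => //; exists (h * g)%g; rewrite actM -iter_act.
  by right; exists n.+1 => //; exists h; rewrite iterSr.
have UV : U `<` V.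
  split; first by left.
  move/(_ x0) => VU; apply/nUx0/VU; right; exists 0 => //; exists 1%g.
  by rewrite act1.
have [m [q [q0 VE]]] := maxU V oV iV UV.
pose O N := (agree m q `|` U) `|` \bigcup_(n in [set n | n <= N]) W n.
have [N|i j|x|N covN] := @directed_cover_compact T cT _ 0 O.
- apply: openU; last exact: bigcup_open.
  apply: openU => //.
  by case: (clopen_label_agree _ _ (iter_continuous m)
    (iter_continuous (m + q))).
- exists (maxn i j) => x [] [Cx|[n /= nN Wx]]; try by left.
    by right; exists n => //=; rewrite leq_max nN.
  by right; exists n => //=; rewrite leq_max nN orbT.
- have [[Ux|[n _ Wx]]|nVx] := pselect (V x).
  + by exists 0; left; right.
  + by exists n; right; exists n => /=.
  + by exists 0; left; left; rewrite /agree /= (VE x nVx : iter m f x = _).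
apply: bU; exists (k + N + m), (k`! * q); split.
  by rewrite muln_gt0 fact_gt0.
move=> x nUx; have [[n nN Wx]|noW] :=
    pselect ((\bigcup_(n in [set n | n <= N]) W n) x).
  apply: eventual_period_le (WE n x nUx Wx); last exact: dvdn_mulr.
  by rewrite -addnA leq_add2l (leq_trans nN) // leq_addr.
apply: (@eventual_period_le _ _ m q); first exact: leq_addl.
  exact: dvdn_mull.
apply: periodic_pt_agree => g; case: (covN (act g x)) => [[//|/iUa//]|].
case=> n nN [h Bx]; case: noW; exists n => //; exists (h * g)%g.
by rewrite actM -iter_act.
Qed.

End ExpansiveAction.

(** * Subshifts *)

Lemma compact_subtype (T : topologicalType) (X : set T) :
  compact X -> compact [set: X].
Proof.
move=> cX F PF _.
have FX : (set_val @ F) X by apply: (@filterE _ F) => x; exact: set_valP.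
have [x [Xx clx]] := cX (set_val @ F) _ FX.
exists (exist _ x (mem_set Xx)); split => // A B FA.
move=> [_ /= [[W oW <-] Wx WB]].
have FvA : (set_val @ F) (set_val @` A).
  by apply: (@filterS _ F _ A) FA => z Az; exists z.
have [y [[z Az zy] Wy]] := clx _ W FvA (open_nbhs_nbhs (conj oW Wx)).
by exists z; split => //; apply: WB; rewrite /= zy.
Qed.

Lemma continuous_ptws {S : topologicalType} {I : Type} {V : topologicalType}
    (phi : S -> {ptws I -> V}) :
  (forall i, continuous (fun x => phi x i)) -> continuous phi.
Proof.
move=> cphi x; apply/cvg_sup => i.
exact: (@continuous_comp_initial _ _ _ (fun u : I -> V => u i) phi (cphi i) x).
Qed.

Theorem corollary1p7 (G : groupType) (G_countable : countable [set: G]%classic)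
  (A : finType) (X : set (config G A)) (hX : subshift X) (f : X -> X)
  (hf : cellular_automaton hX f) :
  weakly_preperiodic f <-> preperiodic f.
Proof.
split=> [wf|[n [p [p0 fnp]]] x]; last by exists n, p; rewrite fnp.
have [f_cont f_shift] := hf.
have eval_cont (h : G) : continuous (fun u : config G A => u h).
  exact: (@proj_continuous G (fun=> discrete_topology A) h).
have shift_cont g : continuous (@shift G A g).
  by apply: continuous_ptws => h; exact: eval_cont.
have val_cont : continuous (set_val : X -> config G A).
  exact: initial_continuous.
apply: (@expansive_preperiodic G X A
    (sub_shift hX) (fun x => set_val x 1%g) f).
- apply: compact_subtype; apply: subclosed_compact hX.1 _ (@subsetT _ X).
  have cA (h : G) : compact [set: discrete_topology A].
    by apply: finite_compact; exact: (@finite_finset A).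
  suff <- : [set u : config G A | forall h, [set: discrete_topology A] (u h)]
      = setT by exact: tychonoff cA.
  by apply/seteqP.
- by move=> x; apply: val_inj; apply: funext => h /=; rewrite /shift invg1 mul1g.
- move=> g h x; apply: val_inj; apply: funext => k.
  suff : set_val x ((g * h)^-1 * k)%g = set_val x (h^-1 * (g^-1 * k))%g by [].
  by rewrite invgM mulgA.
- move=> g; apply: continuous_comp_initial => x.
  exact: (continuous_comp (val_cont x) (shift_cont g _)).
- move=> a.
  apply: (open_comp _ (@discrete_open (discrete_topology A) [set a])) => x _.
  exact: (continuous_comp (val_cont x) (eval_cont 1%g _)).
- move=> x y xy; apply: val_inj; apply: funext => h.
  (* The translate by h^-1 brings the coordinate h to the identity. *)
  suff : set_val x (h^-1^-1 * 1)%g = set_val y (h^-1^-1 * 1)%g.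
    by rewrite invgK mulg1.
  exact: (xy h^-1%g).
- exact: f_cont.
- by move=> g x; exact: f_shift.
- exact: wf.
Qed.
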